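(* The unique solution $(T_{2h},s_{2h})$ to problem $(\mathrm{P}_{2h})$ converges to the unique solution $(T_2,s_2)$ to problem $(\mathrm{P}_2)$ when the heat transfer coefficient $h$ goes to infinity (all other parameters being fixed); that is, as $h\to\infty$, $s_{2h}(t)\to s_2(t)$ for every $t>0$, and $T_{2h}(x,t)\to T_2(x,t)$ for every $t>0$ and $0<x<s_2(t)$.
   Context: Fix real parameters $k,\rho,c,\gamma,\theta_\infty>0$ and $\alpha\ge 0$; put $a=\sqrt{k/(\rho c)}$ and $\mathrm{Ste}=\dfrac{k\theta_\infty}{\gamma a^{\alpha+2}}$. For $h>0$ put $\mathrm{Bi}=\dfrac{ah}{k}$. A candidate pair $(T,s)$ consists of a continuous function $s:[0,\infty)\to[0,\infty)$, positive and continuously differentiable on $(0,\infty)$, and a function $$T(x,t)=t^{\alpha/2}\theta_\infty\left[A\left(1-\frac{x}{s(t)}\right)+B\left(1-\frac{x}{s(t)}\right)^2\right],\quad 0\le x\le s(t),\ t>0,$$ with real constants $A,B$. Problem $(\mathrm{P}_{2h})$: find a candidate pair such that, for all $t>0$: (i) $\frac{d}{dt}\int_0^{s(t)}T(x,t)\,dx=-a^2\left[\frac{\gamma}{k}s(t)^{\alpha}\dot s(t)+\frac{\partial T}{\partial x}(0,t)\right]$; (ii) $k\frac{\partial T}{\partial x}(0,t)=\frac{h}{\sqrt t}\left[T(0,t)-\theta_\infty t^{\alpha/2}\right]$; (iii) $T(s(t),t)=0$; (iv) $k\frac{\partial T}{\partial x}(s(t),t)=-\gamma s(t)^{\alpha}\dot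 s(t)$; and (v) $s(0)=0$. Problem $(\mathrm{P}_2)$: the same with (ii) replaced by $T(0,t)=\theta_\infty t^{\alpha/2}$. The unique solution of $(\mathrm{P}_{2h})$ is the candidate pair with $s_{2h}(t)=2a\nu_{2h}\sqrt t$ and constants $$A_{2h}=\frac{6\,\mathrm{Ste}-2\,\mathrm{Ste}\,\nu_{2h}^2(\alpha+1)-\frac{3}{\mathrm{Bi}}2^{\alpha+1}\nu_{2h}^{\alpha+1}-3\cdot 2^{\alpha+1}\nu_{2h}^{\alpha+2}}{\mathrm{Ste}\left[\nu_{2h}^2(\alpha+1)+\frac{2}{\mathrm{Bi}}\nu_{2h}(\alpha+1)+3\right]},\quad B_{2h}=\frac{-3\,\mathrm{Ste}+3\,\mathrm{Ste}\,\nu_{2h}^2(\alpha+1)+\frac{3}{\mathrm{Bi}}2^{\alpha}\nu_{2h}^{\alpha+1}+3\cdot 2^{\alpha+1}\nu_{2h}^{\alpha+2}}{\mathrm{Ste}\left[\nu_{2h}^2(\alpha+1)+\frac{2}{\mathrm{Bi}}\nu_{2h}(\alpha+1)+3\right]},$$ where $\nu_{2h}$ is the unique positive root of $2^{\alpha}(\alpha+1)z^{\alpha+4}+\frac{2^{\alpha+1}}{\mathrm{Bi}}(\alpha+1)z^{\alpha+3}+3\cdot 2^{\alpha+1}z^{\alpha+2}+3\frac{2^{\alpha}}{\mathrm{Bi}}z^{\alpha+1}+\mathrm{Ste}(\alpha+1)z^2-3\,\mathrm{Ste}=0$. The unique solution of $(\mathrm{P}_2)$ is the candidate pair with $s_2(t)=2a\nu_2\sqrt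 t$ and constants $$A_2=\frac{6\,\mathrm{Ste}-2\,\mathrm{Ste}\,\nu_2^2(\alpha+1)-3\cdot 2^{\alpha+1}\nu_2^{\alpha+2}}{\mathrm{Ste}\left(\nu_2^2(\alpha+1)+3\right)},\quad B_2=\frac{-3\,\mathrm{Ste}+3\,\mathrm{Ste}\,\nu_2^2(\alpha+1)+3\cdot 2^{\alpha+1}\nu_2^{\alpha+2}}{\mathrm{Ste}\left(\nu_2^2(\alpha+1)+3\right)},$$ where $\nu_2$ is the unique positive root of $2^{\alpha}(\alpha+1)z^{\alpha+4}+3\cdot 2^{\alpha+1}z^{\alpha+2}+\mathrm{Ste}(\alpha+1)z^2-3\,\mathrm{Ste}=0$. In the convergence of $T_{2h}(x,t)$, for fixed $(x,t)$ one considers $h$ large enough that $x<s_{2h}(t)$. *)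

(* Defs.v *)
From Stdlib Require Import Reals.
From Coquelicot Require Import Coquelicot.
Open Scope R_scope.

(* [Rpower] is the real power of a positive base; every base below ([t], and
   [s t] for a candidate) is positive where the conditions are imposed. *)

Definition diffusion_a (k rho c : R) : R := sqrt (k / (rho * c)).

(* [T] is only meaningful on [0 <= x <= s t], so its space derivatives at the
   two ends of that interval are the one-sided ones. *)
Definition is_right_derive (f : R -> R) (x l : R) : Prop :=
  filterlim (fun y => (f y - f x) / (y - x)) (at_right x) (locally l).

Definition is_left_derive (f : R -> R) (x l : R) : Prop :=
  filterlim (fun y => (f y - f x) / (y - x)) (at_left x) (locally l).

(* [T] and [s] are total functions; the values of [T] outside
   [0 <= x <= s t, 0 < t] and of [s] outside [0 <= t] are irrelevant. *)
Definition candidate (alpha theta : R) (T : R -> R -> R) (s : R -> R) : Prop :=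
  continuous_on (fun t => 0 <= t) s /\
  (forall t, 0 <= t -> 0 <= s t) /\
  (forall t, 0 < t -> 0 < s t /\ ex_derive s t /\ continuous (Derive s) t) /\
  exists A B : R, forall x t, 0 < t -> 0 <= x <= s t ->
    T x t = Rpower t (alpha / 2) * theta *
            (A * (1 - x / s t) + B * (1 - x / s t) ^ 2).

(* The condition at the fixed face [x = 0] is the parameter [face], a relation
   between [t], [T 0 t] and the derivative of [T] in [x] at [(0, t)]. *)
Definition stefan_problem (k rho c gamma theta alpha : R)
    (face : R -> R -> R -> Prop) (T : R -> R -> R) (s : R -> R) : Prop :=
  candidate alpha theta T s /\
  (forall t, 0 < t -> exists Tx0 Txs : R,
     is_right_derive (fun x => T x t) 0 Tx0 /\
     is_left_derive (fun x => T x t) (s t) Txs /\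
     is_derive (fun u => RInt (fun x => T x u) 0 (s u)) t
       (- (diffusion_a k rho c) ^ 2 *
          (gamma / k * Rpower (s t) alpha * Derive s t + Tx0)) /\
     face t (T 0 t) Tx0 /\
     T (s t) t = 0 /\
     k * Txs = - gamma * Rpower (s t) alpha * Derive s t) /\
  s 0 = 0.

Definition P2h (k rho c gamma theta alpha h : R) :
    (R -> R -> R) -> (R -> R) -> Prop :=
  stefan_problem k rho c gamma theta alpha
    (fun t T0 Tx0 =>
       k * Tx0 = h / sqrt t * (T0 - theta * Rpower t (alpha / 2))).

Definition P2 (k rho c gamma theta alpha : R) :
    (R -> R -> R) -> (R -> R) -> Prop :=
  stefan_problem k rho c gamma theta alpha
    (fun t T0 _ => T0 = theta * Rpower t (alpha / 2)).

Definition same_pair (T1 : R -> R -> R) (s1 : R -> R)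
    (T2 : R -> R -> R) (s2 : R -> R) : Prop :=
  (forall t, 0 <= t -> s1 t = s2 t) /\
  (forall x t, 0 < t -> 0 <= x <= s1 t -> T1 x t = T2 x t).

Definition has_unique_solution
    (P : (R -> R -> R) -> (R -> R) -> Prop) : Prop :=
  exists T s, P T s /\ forall T' s', P T' s' -> same_pair T s T' s'.

(* Main.v *)
Require Import Defs.
From Stdlib Require Import Reals Lra Psatz Ranalysis5.
From Coquelicot Require Import Coquelicot.
Open Scope R_scope.

(* The condition (iv) is a separable ODE for [s], so every solution has
   [s t = sg * sqrt t] with [A] a multiple of [sg ^ (alpha + 2)]; then (i) and
   the condition at [x = 0] become algebraic. Eliminating [B] leaves one equation
   [front_fun e sg = 0], where [e = k / h], or [e = 0] for the Dirichlet condition,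
   which is strictly increasing in [sg] and nondecreasing in [e]. This gives existence
   and uniqueness, and convergence of the root as [e] tends to [0]. Since [B] is
   also a function of [sg] alone, [T] converges by continuity. Here [sg] is
   [2 a nu] in the notation of the paper. *)

(** * Real powers of a positive base *)

Lemma Rpower_succ x p : 0 < x -> Rpower x (p + 1) = Rpower x p * x.
Proof. intros hx. now rewrite Rpower_plus, Rpower_1. Qed.

Lemma Rpower_pos x p : 0 < Rpower x p.
Proof. apply exp_pos. Qed.

Lemma Rpower_lt_base x y p : 0 < p -> 0 < x < y -> Rpower x p < Rpower y p.
Proof.
  intros hp [hx hxy]. apply exp_increasing, Rmult_lt_compat_l; auto.
  now apply ln_increasing.
Qed.

Lemma Rpower_inj_base x y p :
  0 < p -> 0 < x -> 0 < y -> Rpower x p = Rpower y p -> x = y.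
Proof.
  intros hp hx hy h. destruct (Rtotal_order x y) as [l|[l|l]]; auto.
  - generalize (Rpower_lt_base x y p hp (conj hx l)); lra.
  - generalize (Rpower_lt_base y x p hp (conj hy l)); lra.
Qed.

Lemma Rpower_le_base_lt_1 x p : 0 < x < 1 -> 1 <= p -> Rpower x p <= x.
Proof.
  intros [hx hx1] hp.
  assert (hl : ln x < 0) by (rewrite <- ln_1; apply ln_increasing; lra).
  rewrite <- (exp_ln x) at 2 by lra.
  destruct (Req_dec (p * ln x) (ln x)) as [e|e].
  - unfold Rpower; rewrite e; lra.
  - left; apply exp_increasing. nra.
Qed.

Lemma Rpower_sqrt_base t p : 0 < t -> Rpower (sqrt t) p = Rpower t (p / 2).
Proof.
  intros ht. rewrite <- Rpower_sqrt, Rpower_mult by auto. f_equal; field.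
Qed.

Lemma is_derive_Rpower t p :
  0 < t -> is_derive (fun u => Rpower u p) t (p * Rpower t p / t).
Proof.
  intros ht. unfold Rpower. auto_derive; [lra|]. field; lra.
Qed.

(** * End-point derivatives and integral of a quadratic profile *)

(** [at_right], [at_left] and [continuous_on] are all limits within a set, so one statement serves
    the three. *)
Lemma continuous_within (g : R -> R) (D : R -> Prop) x l :
  continuous g x -> g x = l -> filterlim g (within D (locally x)) (locally l).
Proof.
  intros hg <-. exact (filterlim_filter_le_1 g (filter_le_within (F := locally x) D) hg).
Qed.

Lemma profile_right_derive f L C A B :
  0 < L ->
  (forall x, 0 <= x <= L -> f x = C * (A * (1 - x / L) + B * (1 - x / L) ^ 2)) ->
  is_right_derive f 0 (- (C * (A + 2 * B) / L)).
Proof.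
  intros hL hf.
  (* On the profile the difference quotient is exactly affine in [y], so its limit is a value of
     that affine function. The profile formula holds only up to distance [L], hence the ball of
     radius [L]. *)
  apply (filterlim_ext_loc (fun y => - (C * (A + 2 * B) / L) + C * B / L ^ 2 * y)).
  - exists (mkposreal L hL). intros y hy hy0.
    change (Rabs (y - 0) < L) in hy. apply Rabs_lt_between in hy.
    rewrite !hf by lra. field; lra.
  - apply continuous_within; [|ring].
    apply (ex_derive_continuous (V := R_NormedModule)). auto_derive; auto.
Qed.

Lemma profile_left_derive f L C A B :
  0 < L ->
  (forall x, 0 <= x <= L -> f x = C * (A * (1 - x / L) + B * (1 - x / L) ^ 2)) ->
  is_left_derive f L (- (C * A / L)).
Proof.
  intros hL hf.
  apply (filterlim_ext_loc (fun y => - (C * A / L) + C * B / L ^ 2 * (y - L))).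
  - exists (mkposreal L hL). intros y hy hy0.
    change (Rabs (y - L) < L) in hy. apply Rabs_lt_between in hy.
    rewrite !hf by lra. field; lra.
  - apply continuous_within; [|ring].
    apply (ex_derive_continuous (V := R_NormedModule)). auto_derive; auto.
Qed.

Lemma is_right_derive_unique f x l1 l2 :
  is_right_derive f x l1 -> is_right_derive f x l2 -> l1 = l2.
Proof. apply (filterlim_locally_unique (V := R_NormedModule)). Qed.

Lemma is_left_derive_unique f x l1 l2 :
  is_left_derive f x l1 -> is_left_derive f x l2 -> l1 = l2.
Proof. apply (filterlim_locally_unique (V := R_NormedModule)). Qed.

Lemma profile_RInt f L C A B :
  0 < L ->
  (forall x, 0 <= x <= L -> f x = C * (A * (1 - x / L) + B * (1 - x / L) ^ 2)) ->
  RInt f 0 L = C * L * (A / 2 + B / 3).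
Proof.
  intros hL hf. apply is_RInt_unique.
  set (g := fun x => C * (A * (1 - x / L) + B * (1 - x / L) ^ 2)).
  apply (is_RInt_ext g).
  { intros x hx. rewrite Rmin_left, Rmax_right in hx by lra.
    symmetry; apply hf; lra. }
  set (G := fun x => - C * L * (A / 2 * (1 - x / L) ^ 2 + B / 3 * (1 - x / L) ^ 3)).
  replace (C * L * (A / 2 + B / 3)) with (minus (G L) (G 0)).
  2:{ unfold G, minus, plus, opp; simpl; field; lra. }
  apply (is_RInt_derive (V := R_CompleteNormedModule) G g).
  - intros x _. unfold G, g. auto_derive; auto. field; lra.
  - intros x _. apply (ex_derive_continuous (V := R_NormedModule)).
    unfold g. auto_derive; auto.
Qed.

(** * Self-similar pairs and the differential equation of the front *)

Definition self_similar (alpha theta A B sg : R) (T : R -> R -> R) (s : R -> R) :=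
  (forall t, 0 <= t -> s t = sg * sqrt t) /\
  forall x t, 0 < t -> 0 <= x <= s t ->
    T x t = Rpower t (alpha / 2) * theta *
            (A * (1 - x / s t) + B * (1 - x / s t) ^ 2).

Lemma is_derive_front sg t :
  0 < t -> is_derive (fun u => sg * sqrt u) t (sg / (2 * sqrt t)).
Proof.
  intros ht. pose proof (sqrt_lt_R0 t ht).
  auto_derive; auto. field; lra.
Qed.

Lemma locally_pos t : 0 < t -> locally t (fun u => 0 < u).
Proof. intros ht. exact (open_gt 0 t ht). Qed.

(** The amplitude scales as [t^(alpha/2)] and the width as [sqrt t], so the integral is a constant
    times [t^((alpha+1)/2)]. *)
Lemma self_similar_derive_energy alpha theta A B sg T s t :
  0 < sg -> self_similar alpha theta A B sg T s -> 0 < t ->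
  is_derive (fun u => RInt (fun x => T x u) 0 (s u)) t
    (theta * sg * (A / 2 + B / 3) * ((alpha + 1) / 2)
     * Rpower t (alpha / 2) / sqrt t).
Proof.
  intros hsg [hs hT] ht.
  apply (is_derive_ext_loc (fun u =>
    theta * sg * (A / 2 + B / 3) * (Rpower u (alpha / 2) * sqrt u))).
  - generalize (locally_pos t ht). apply filter_imp. intros u hu.
    pose proof (sqrt_lt_R0 u hu).
    rewrite (profile_RInt _ (s u) (Rpower u (alpha / 2) * theta) A B).
    + rewrite hs by lra. match goal with |- ?a = ?b => change (a = b :> R) end. ring.
    + rewrite hs by lra. nra.
    + intros; apply hT; auto.
  - pose proof (sqrt_lt_R0 t ht). pose proof (sqrt_sqrt t (Rlt_le _ _ ht)).
    unfold Rpower. auto_derive; [lra|].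
    (* With [t] written as [sqrt t * sqrt t], the sum [alpha / (2 t) * sqrt t + 1 / (2 sqrt t)]
       becomes [(alpha + 1) / (2 sqrt t)]. *)
    set (E := exp _). rewrite <- H0 at 1. field; lra.
Qed.

(* The ODE reads [(s^(alpha+2))' = 2 K (t^(alpha/2+1))'], and the constant of
   integration vanishes because [s] tends to [0] at [0]. *)
Lemma front_ode_self_similar alpha K (s : R -> R) :
  0 <= alpha ->
  continuous_on (fun t => 0 <= t) s -> s 0 = 0 ->
  (forall t, 0 < t -> 0 < s t /\ ex_derive s t) ->
  (forall t, 0 < t ->
     Rpower (s t) (alpha + 1) * Derive s t = K * Rpower t (alpha / 2)) ->
  2 * K = Rpower (s 1) (alpha + 2) /\
  forall t, 0 <= t -> s t = s 1 * sqrt t.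
Proof.
  intros ha hcont hs0 hs hode.
  set (G := fun t => Rpower (s t) (alpha + 2) - 2 * K * Rpower t (alpha / 2 + 1)).
  assert (hG' : forall t, 0 < t -> is_derive G t 0).
  { intros t ht. destruct (hs t ht) as [hst hd].
    replace 0 with (minus (scal (Derive s t) ((alpha + 2) * Rpower (s t) (alpha + 2) / s t))
      (scal (2 * K) ((alpha / 2 + 1) * Rpower t (alpha / 2 + 1) / t))).
    - apply (is_derive_minus (V := R_NormedModule)).
      + apply (is_derive_comp (fun u => Rpower u (alpha + 2)) s).
        * now apply is_derive_Rpower.
        * now apply Derive_correct.
      + apply (is_derive_scal (fun t => Rpower t (alpha / 2 + 1))).
        now apply is_derive_Rpower.
    - unfold minus, plus, opp, scal; simpl; unfold mult; simpl.
      replace (alpha + 2) with (alpha + 1 + 1) at 2 by ring.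
      rewrite !Rpower_succ by auto.
      apply Rminus_diag_eq.
      transitivity ((alpha + 2) * (Rpower (s t) (alpha + 1) * Derive s t)).
      { rewrite Rpower_succ by auto. field; lra. }
      rewrite hode by auto. field; lra. }
  assert (hGc : forall t, 0 < t -> G t = G 1).
  { intros t ht. destruct (MVT_gen G t 1 (fun _ => 0)) as [x [_ hx]].
    - intros x hx. apply hG'. generalize (Rmin_glb_lt t 1 0 ht Rlt_0_1); lra.
    - intros x hx. apply derivable_continuous_pt.
      exists 0. apply is_derive_Reals, hG'.
      generalize (Rmin_glb_lt t 1 0 ht Rlt_0_1); lra.
    - lra. }
  assert (hG1 : G 1 = 0).
  (* [G] cannot simply be evaluated at 0, since [Rpower 0 p] is 1. Instead, [e = Rabs (G t)] for
     every [t > 0], while for small [t] the two terms of [G] are below [e / 2] and at most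
     [e / 4]. *)
  { destruct (Req_dec (G 1) 0) as [|hne]; auto. exfalso.
    pose proof (Rabs_pos_lt _ hne) as hpos.
    set (e := Rabs (G 1)) in *.
    assert (hK := Rabs_pos K).
    assert (he1 : 0 < Rmin 1 (e / 2)) by (apply Rmin_glb_lt; lra).
    assert (hc0 := hcont 0 (Rle_refl 0)). rewrite hs0 in hc0.
    destruct (proj1 (filterlim_locally _ _) hc0 (mkposreal _ he1)) as [d hd].
    simpl in hd.
    (* The three bounds keep [t] inside the continuity radius [d], below 1 so that its power is at
       most [t], and small enough for [Rabs K * t <= e / 8]. *)
    set (t := Rmin (d / 2) (Rmin (1 / 2) (e / (8 * (Rabs K + 1))))).
    assert (hd0 := cond_pos d).
    assert (ht : 0 < t).
    { apply Rmin_glb_lt; [lra|apply Rmin_glb_lt; [lra|]].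
      apply Rdiv_lt_0_compat; lra. }
    assert (ht1 : t <= d / 2) by apply Rmin_l.
    assert (ht2 : t <= 1 / 2) by (eapply Rle_trans; [apply Rmin_r|apply Rmin_l]).
    assert (ht3 : t <= e / (8 * (Rabs K + 1)))
      by (eapply Rle_trans; [apply Rmin_r|apply Rmin_r]).
    assert (hst : Rabs (s t - 0) < Rmin 1 (e / 2)).
    { apply (hd t); [|lra]. change (Rabs (t - 0) < d).
      rewrite Rabs_pos_eq; lra. }
    destruct (hs t ht) as [hp _].
    rewrite Rminus_0_r, Rabs_pos_eq in hst by lra.
    assert (h1 : s t < 1) by (eapply Rlt_le_trans; [apply hst|apply Rmin_l]).
    assert (h2 : s t < e / 2) by (eapply Rlt_le_trans; [apply hst|apply Rmin_r]).
    assert (b1 : Rpower (s t) (alpha + 2) <= s t) by (apply Rpower_le_base_lt_1; lra).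
    assert (b2 : Rpower t (alpha / 2 + 1) <= t) by (apply Rpower_le_base_lt_1; lra).
    assert (b3 : Rabs K * t <= e / 8).
    { apply Rle_trans with ((Rabs K + 1) * (e / (8 * (Rabs K + 1)))).
      - apply Rmult_le_compat; lra.
      - right; field; lra. }
    assert (p1 := Rpower_pos (s t) (alpha + 2)).
    assert (p2 := Rpower_pos t (alpha / 2 + 1)).
    assert (b4 : Rabs K * Rpower t (alpha / 2 + 1) <= e / 8) by nra.
    assert (hle : e <= Rpower (s t) (alpha + 2) + 2 * (Rabs K * Rpower t (alpha / 2 + 1))).
    { unfold e. rewrite <- (hGc t ht). unfold G, Rminus.
      eapply Rle_trans; [apply Rabs_triang|].
      rewrite Rabs_Ropp, !Rabs_mult, (Rabs_pos_eq 2), !(Rabs_pos_eq (Rpower _ _)) by lra.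
      lra. }
    lra. }
  assert (h1 : 2 * K = Rpower (s 1) (alpha + 2)).
  { unfold G in hG1. unfold Rpower at 2 in hG1; rewrite ln_1, Rmult_0_r, exp_0 in hG1. lra. }
  split; auto. intros t [ht| <-].
  - destruct (hs t ht) as [hst _]. destruct (hs 1 Rlt_0_1) as [hs1 _].
    pose proof (sqrt_lt_R0 t ht).
    (* Both sides are positive, so it suffices to compare their powers of exponent [alpha + 2],
       which [G t = 0] does. *)
    apply (Rpower_inj_base _ _ (alpha + 2)); [lra|auto|nra|].
    rewrite <- Rpower_mult_distr, Rpower_sqrt_base, <- h1 by auto.
    pose proof (hGc t ht) as h. rewrite hG1 in h. unfold G in h.
    replace ((alpha + 2) / 2) with (alpha / 2 + 1) by field. lra.
  - rewrite hs0, sqrt_0. ring.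
Qed.

(** * The algebraic system for the coefficients and the front *)

(** The value of [A] forced by (iv), equal to [kap * sg^(alpha+2)]. It is split so that [front_fun]
    contains only the power [sg^(alpha+1)]. *)
Definition lin_coef (kap alpha sg : R) : R := kap * Rpower sg (alpha + 1) * sg.

(** The solution [B] of the energy balance [m sg^2 (A/2 + B/3) = B] with
    [A = lin_coef kap alpha sg], meaningful when [m sg^2] differs from 3. *)
Definition quad_coef (m kap alpha sg : R) : R :=
  3 * (m * sg ^ 2) * lin_coef kap alpha sg / (2 * (3 - m * sg ^ 2)).

(** The residual [e (A + 2 B) + sg (A + B - 1)] of the face condition with [A] and [B] substituted,
    times [2 (3 - m sg^2) / sg]. For the physical [m] and [kap], [e = k / h] and [sg = 2 a nu],
    multiplying by [Ste / 2] gives the equation for [nu]. *)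
Definition front_fun (m kap alpha e sg : R) : R :=
  m * sg ^ 2 * (lin_coef kap alpha sg + 2) + 6 * lin_coef kap alpha sg - 6
  + 2 * e * kap * Rpower sg (alpha + 1) * (2 * m * sg ^ 2 + 3).

Lemma lin_coef_pos kap alpha sg : 0 < kap -> 0 < sg -> 0 < lin_coef kap alpha sg.
Proof.
  intros hk hs. unfold lin_coef. pose proof (Rpower_pos sg (alpha + 1)).
  repeat apply Rmult_lt_0_compat; auto.
Qed.

Lemma lin_coef_eq kap alpha sg :
  0 < sg -> lin_coef kap alpha sg = kap * Rpower sg (alpha + 2).
Proof.
  intros hs. unfold lin_coef. replace (alpha + 2) with (alpha + 1 + 1) by ring.
  rewrite (Rpower_succ sg (alpha + 1)) by auto. ring.
Qed.

(** If [m sg^2 >= 3], the first term alone exceeds 6 and [front_fun] is positive. The bound keeps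
    the denominator of [quad_coef] positive at a root. *)
Lemma front_root_lt m kap alpha e sg :
  0 < m -> 0 < kap -> 0 <= e -> 0 < sg ->
  front_fun m kap alpha e sg = 0 -> m * sg ^ 2 < 3.
Proof.
  intros hm hk he hs h. unfold front_fun in h.
  pose proof (lin_coef_pos kap alpha sg hk hs).
  pose proof (Rpower_pos sg (alpha + 1)).
  assert (0 < m * sg ^ 2) by (apply Rmult_lt_0_compat; auto; nra).
  assert (0 <= 2 * e * kap * Rpower sg (alpha + 1) * (2 * m * sg ^ 2 + 3)).
  { repeat apply Rmult_le_pos; nra. }
  nra.
Qed.

Lemma coef_system m kap alpha e sg A B :
  0 < m -> 0 < kap -> 0 <= e -> 0 < sg -> A = lin_coef kap alpha sg ->
  (m * sg ^ 2 * (A / 2 + B / 3) = B /\ e * (A + 2 * B) + sg * (A + B - 1) = 0)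
  <-> (B = quad_coef m kap alpha sg /\ front_fun m kap alpha e sg = 0).
Proof.
  intros hm hk he hs hA.
  pose proof (lin_coef_pos kap alpha sg hk hs) as hpos. rewrite <- hA in hpos.
  assert (hF : sg * front_fun m kap alpha e sg =
    3 * (m * sg ^ 2) * A * (sg + 2 * e)
    - (6 - 2 * (m * sg ^ 2)) * (sg - A * (sg + e))).
  { rewrite hA. unfold front_fun, lin_coef. ring. }
  unfold quad_coef. rewrite <- hA.
  split.
  - intros [h1 h2].
    (* At [m sg^2 = 3] the energy balance cancels [B] and leaves [A = 0], against [A > 0]. *)
    assert (hne : 3 - m * sg ^ 2 <> 0) 
      by (intro h3; replace (m * sg ^ 2) with 3 in h1 by lra; lra).
    assert (hB : B * (2 * (3 - m * sg ^ 2)) = 3 * (m * sg ^ 2) * A) by lra.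
    split.
    + rewrite <- hB. field; auto.
    + apply (Rmult_eq_reg_l sg); [|lra]. rewrite hF, Rmult_0_r, <- hB.
      replace (sg - A * (sg + e)) with (B * (sg + 2 * e)) by lra. ring.
  - intros [hB h].
    pose proof (front_root_lt m kap alpha e sg hm hk he hs h) as hlt.
    rewrite h, Rmult_0_r in hF. split.
    + rewrite hB. field; lra.
    + apply (Rmult_eq_reg_l (2 * (3 - m * sg ^ 2))); [|lra].
      rewrite Rmult_0_r, hF, hB. field; lra.
Qed.

(** Every nonconstant term is a product of positive increasing factors. The term carrying [e] may
    vanish, so strictness comes from the others. *)
Lemma front_fun_increasing m kap alpha e x y :
  0 < m -> 0 < kap -> 0 <= alpha -> 0 <= e -> 0 < x < y ->
  front_fun m kap alpha e x < front_fun m kap alpha e y.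
Proof.
  intros hm hk ha he hxy. unfold front_fun, lin_coef.
  assert (hR := Rpower_lt_base x y (alpha + 1) ltac:(lra) hxy).
  assert (hp := Rpower_pos x (alpha + 1)).
  set (p := Rpower x _) in *. set (q := Rpower y _) in *.
  assert (hsq : x ^ 2 < y ^ 2) by nra.
  assert (hm2 : m * x ^ 2 < m * y ^ 2) by nra.
  assert (hm0 : 0 < m * x ^ 2) by (apply Rmult_lt_0_compat; nra).
  assert (hkp : 0 < kap * p) by (apply Rmult_lt_0_compat; auto).
  assert (hkq : kap * p < kap * q) by nra.
  assert (hl : kap * p * x < kap * q * y) by (apply Rmult_le_0_lt_compat; lra).
  assert (hl0 : 0 < kap * p * x) by (apply Rmult_lt_0_compat; lra).
  assert (h1 : m * x ^ 2 * (kap * p * x + 2) < m * y ^ 2 * (kap * q * y + 2))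
    by (apply Rmult_le_0_lt_compat; lra).
  assert (h2 : kap * p * (2 * m * x ^ 2 + 3) < kap * q * (2 * m * y ^ 2 + 3))
    by (apply Rmult_le_0_lt_compat; lra).
  assert (h3 : e * (kap * p * (2 * m * x ^ 2 + 3)) <= e * (kap * q * (2 * m * y ^ 2 + 3)))
    by (apply Rmult_le_compat_l; lra).
  lra.
Qed.

(** * Existence, uniqueness and convergence of the root *)

Lemma front_root_unique m kap alpha e x y :
  0 < m -> 0 < kap -> 0 <= alpha -> 0 <= e -> 0 < x -> 0 < y ->
  front_fun m kap alpha e x = 0 -> front_fun m kap alpha e y = 0 -> x = y.
Proof.
  intros hm hk ha he hx hy ex ey.
  destruct (Rtotal_order x y) as [l|[l|l]]; auto.
  - pose proof (front_fun_increasing m kap alpha e x y); lra.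
  - pose proof (front_fun_increasing m kap alpha e y x); lra.
Qed.

Lemma continuous_lin_coef kap alpha x :
  0 < x -> continuous (lin_coef kap alpha) x.
Proof.
  intros hx. apply (ex_derive_continuous (V := R_NormedModule)).
  unfold lin_coef, Rpower. auto_derive; auto.
Qed.

Lemma continuous_quad_coef m kap alpha x :
  0 < x -> m * x ^ 2 < 3 -> continuous (quad_coef m kap alpha) x.
Proof.
  intros hx h3. apply (ex_derive_continuous (V := R_NormedModule)).
  unfold quad_coef, lin_coef, Rpower. auto_derive. repeat split; auto. simpl in h3; lra.
Qed.

Lemma front_root_exists m kap alpha e :
  0 < m -> 0 < kap -> 0 <= alpha -> 0 <= e ->
  exists sg, 0 < sg /\ front_fun m kap alpha e sg = 0.
Proof.
  intros hm hk ha he.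
  (* For [0 < x < 1] the power [x^(alpha+1)] is at most [x], so [front_fun] is at most [x * M - 6].
     The choice [x0 = 1 / (1 + M)] makes this negative. *)
  set (M := m * (kap + 2) + 6 * kap + 2 * e * kap * (2 * m + 3)).
  assert (hek : 0 <= e * kap) by (apply Rmult_le_pos; lra).
  assert (hM : 0 < M) by (unfold M; nra).
  set (x0 := / (1 + M)).
  assert (hx0 : 0 < x0) by (apply Rinv_0_lt_compat; lra).
  assert (hx1 : x0 < 1) by (rewrite <- Rinv_1; apply Rinv_lt_contravar; lra).
  assert (hxM : x0 * (1 + M) = 1) by (apply Rinv_l; lra).
  assert (f0 : front_fun m kap alpha e x0 < 0).
  { unfold front_fun, lin_coef.
    assert (hp := Rpower_pos x0 (alpha + 1)).
    assert (hpx := Rpower_le_base_lt_1 x0 (alpha + 1) (conj hx0 hx1) ltac:(lra)).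
    set (p := Rpower x0 _) in *.
    assert (a1 : kap * p * x0 <= kap * x0) by (apply Rmult_le_compat_r; nra).
    assert (a0 : 0 < kap * p * x0) by (repeat apply Rmult_lt_0_compat; auto).
    assert (a2 : x0 ^ 2 <= x0) by nra.
    assert (a3 : m * x0 ^ 2 * (kap * p * x0 + 2) <= m * x0 * (kap + 2)).
    { apply Rmult_le_compat; nra. }
    assert (a4 : p * (2 * m * x0 ^ 2 + 3) <= x0 * (2 * m + 3)).
    { apply Rmult_le_compat; nra. }
    assert (a5 : e * kap * (p * (2 * m * x0 ^ 2 + 3)) <= e * kap * (x0 * (2 * m + 3)))
      by (apply Rmult_le_compat_l; auto).
    unfold M in hxM. nra. }
  (* Chosen so that [m x1^2 = 4], beyond the bound 3 on roots, which makes [front_fun] positive. *)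
  set (x1 := 2 / sqrt m).
  assert (hsm := sqrt_lt_R0 m hm).
  assert (hx1' : 0 < x1) by (apply Rdiv_lt_0_compat; lra).
  assert (f1 : 0 < front_fun m kap alpha e x1).
  { assert (hmx : m * x1 ^ 2 = 4).
    { unfold x1. rewrite <- (sqrt_sqrt m) at 1 by lra. field; lra. }
    unfold front_fun. rewrite hmx.
    pose proof (lin_coef_pos kap alpha x1 hk hx1').
    assert (0 <= 2 * e * kap * Rpower x1 (alpha + 1) * (2 * m * x1 ^ 2 + 3)).
    { pose proof (Rpower_pos x1 (alpha + 1)). repeat apply Rmult_le_pos; nra. }
    lra. }
  assert (hlt : x0 < x1).
  { destruct (Rtotal_order x0 x1) as [l|[l|l]]; auto.
    - rewrite l in f0; lra.
    - pose proof (front_fun_increasing m kap alpha e x1 x0); lra. }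
  destruct (IVT_interv (front_fun m kap alpha e) x0 x1) as [z [hz fz]]; auto.
  - intros a haa. apply continuity_pt_filterlim.
    apply (ex_derive_continuous (V := R_NormedModule)).
    unfold front_fun, lin_coef, Rpower. auto_derive. repeat split; lra.
  - exists z; split; auto; lra.
Qed.

(** The term carrying [e] is nonnegative, so beyond the root for [e = 0] the function is already
    positive. *)
Lemma front_root_antitone m kap alpha e x y :
  0 < m -> 0 < kap -> 0 <= alpha -> 0 <= e -> 0 < x -> 0 < y ->
  front_fun m kap alpha e x = 0 -> front_fun m kap alpha 0 y = 0 -> x <= y.
Proof.
  intros hm hk ha he hx hy ex ey.
  destruct (Rle_or_lt x y) as [|l]; auto. exfalso.
  pose proof (front_fun_increasing m kap alpha e y x hm hk ha he (conj hy l)) as hlt.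
  rewrite ex in hlt. unfold front_fun in ey, hlt.
  assert (0 <= 2 * e * kap * Rpower y (alpha + 1) * (2 * m * y ^ 2 + 3)).
  { pose proof (Rpower_pos y (alpha + 1)). repeat apply Rmult_le_pos; nra. }
  lra.
Qed.

(** A squeeze: [root0] bounds every [root h] above, and a point [x] just below [root0] bounds it
    below once [front_fun] at [x] is still negative for [e = k / h]. *)
Lemma front_root_lim m kap alpha k (root : R -> R) root0 :
  0 < m -> 0 < kap -> 0 <= alpha -> 0 < k -> 0 < root0 ->
  front_fun m kap alpha 0 root0 = 0 ->
  (forall h, 0 < h -> 0 < root h /\ front_fun m kap alpha (k / h) (root h) = 0) ->
  is_lim root p_infty root0.
Proof.
  intros hm hk ha hkk h0 e0 hr.
  apply is_lim_spec. intros eps. simpl.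
  (* Within [eps / 2] of [root0], and at least [root0 / 2] so that [x] stays positive. *)
  set (x := Rmax (root0 / 2) (root0 - eps / 2)).
  assert (he := cond_pos eps).
  assert (hx0 : 0 < x) by (apply Rlt_le_trans with (root0 / 2); [lra|apply Rmax_l]).
  assert (hx1 : x < root0) by (apply Rmax_lub_lt; lra).
  assert (hx2 : root0 - eps / 2 <= x) by apply Rmax_r.
  assert (hF := front_fun_increasing m kap alpha 0 x root0 hm hk ha (Rle_refl 0) (conj hx0 hx1)).
  rewrite e0 in hF.
  (* [front_fun] is affine in [e], and [d] is its slope at [x]. The threshold below is the [h] at
     which [(k / h) * d] offsets the negative value at [e = 0]. *)
  set (d := 2 * kap * Rpower x (alpha + 1) * (2 * m * x ^ 2 + 3)).
  assert (hd : 0 < d).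
  { unfold d. pose proof (Rpower_pos x (alpha + 1)).
    repeat apply Rmult_lt_0_compat; try lra. nra. }
  exists (k * d / - front_fun m kap alpha 0 x). intros h hh.
  assert (hpos : 0 < h).
  { eapply Rlt_trans; [|apply hh]. apply Rdiv_lt_0_compat; nra. }
  destruct (hr h hpos) as [hrp hre].
  assert (hke : 0 < k / h) by (apply Rdiv_lt_0_compat; auto).
  assert (up := front_root_antitone m kap alpha (k / h) (root h) root0
    hm hk ha (Rlt_le _ _ hke) hrp h0 hre e0).
  assert (hneg : front_fun m kap alpha (k / h) x < 0).
  { replace (front_fun m kap alpha (k / h) x)
      with (front_fun m kap alpha 0 x + k * d / h)
      by (unfold front_fun, d; field; lra).
    apply (Rmult_lt_compat_r (- front_fun m kap alpha 0 x)) in hh; [|lra].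
    replace (k * d / - front_fun m kap alpha 0 x * - front_fun m kap alpha 0 x)
      with (k * d) in hh by (field; lra).
    apply (Rmult_lt_reg_r h); auto.
    replace ((front_fun m kap alpha 0 x + k * d / h) * h)
      with (front_fun m kap alpha 0 x * h + k * d) by (field; lra).
    lra. }
  assert (lo : x < root h).
  { destruct (Rtotal_order x (root h)) as [l|[l|l]]; auto.
    - rewrite l in hneg; lra.
    - pose proof (front_fun_increasing m kap alpha (k / h) (root h) x); lra. }
  apply Rabs_lt_between. lra.
Qed.

(** * The two conditions at the fixed face *)

(* Dirichlet data is the case [e = 0], convective data the case [e = k / h]. *)
Definition robin_face (theta alpha e : R) (face : R -> R -> R -> Prop) : Prop :=
  forall A B sg t, 0 < sg -> 0 < t ->
    face t (Rpower t (alpha / 2) * theta * (A + B))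
      (- (Rpower t (alpha / 2) * theta * (A + 2 * B) / (sg * sqrt t)))
    <-> e * (A + 2 * B) + sg * (A + B - 1) = 0.

Lemma robin_face_dirichlet theta alpha :
  0 < theta ->
  robin_face theta alpha 0 (fun t T0 _ => T0 = theta * Rpower t (alpha / 2)).
Proof.
  intros hth A B sg t hs ht. pose proof (Rpower_pos t (alpha / 2)) as hp.
  set (q := Rpower t _) in *.
  assert (hq : 0 < q * theta) by (apply Rmult_lt_0_compat; auto).
  split; intros h.
  - assert (A + B = 1) by (apply (Rmult_eq_reg_l (q * theta)); lra).
    replace (A + B - 1) with 0 by lra. ring.
  - assert (A + B - 1 = 0) by (apply (Rmult_eq_reg_l sg); lra).
    replace (A + B) with 1 by lra. ring.
Qed.

Lemma robin_face_convective k theta alpha h :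
  0 < k -> 0 < theta -> 0 < h ->
  robin_face theta alpha (k / h)
    (fun t T0 Tx0 =>
       k * Tx0 = h / sqrt t * (T0 - theta * Rpower t (alpha / 2))).
Proof.
  intros hk hth hh A B sg t hs ht. pose proof (Rpower_pos t (alpha / 2)) as hp.
  pose proof (sqrt_lt_R0 t ht) as hr.
  set (q := Rpower t _) in *. set (r := sqrt t) in *.
  assert (hc : 0 < h * q * theta / (sg * r)).
  { apply Rdiv_lt_0_compat; repeat apply Rmult_lt_0_compat; auto. }
  (* The residual of the convective condition is a positive multiple of the algebraic one, with a
     factor independent of [A] and [B]. *)
  assert (he : h / r * (q * theta * (A + B) - theta * q)
               - k * - (q * theta * (A + 2 * B) / (sg * r))
               = h * q * theta / (sg * r)
                 * (k / h * (A + 2 * B) + sg * (A + B - 1)))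
    by (field; lra).
  split; intros h1.
  - apply (Rmult_eq_reg_l (h * q * theta / (sg * r))); lra.
  - rewrite h1 in he. lra.
Qed.

(** * Equivalence of the Stefan problem with the front equation *)

(** Equal to [1 / (2 Ste a^(alpha+2))]; it is the [kap] of the algebraic part. *)
Definition growth_const (k gamma theta : R) : R := gamma / (2 * k * theta).

(** The [m] of the algebraic part: [m sg^2 = (alpha + 1) nu^2] when [sg = 2 a nu]. *)
Definition energy_const (k rho c alpha : R) : R :=
  (alpha + 1) / (4 * diffusion_a k rho c ^ 2).

Lemma growth_const_pos k gamma theta :
  0 < k -> 0 < gamma -> 0 < theta -> 0 < growth_const k gamma theta.
Proof.
  intros. apply Rdiv_lt_0_compat; auto. repeat apply Rmult_lt_0_compat; lra.
Qed.

Lemma diffusion_sq_pos k rho c :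
  0 < k -> 0 < rho -> 0 < c -> 0 < diffusion_a k rho c ^ 2.
Proof.
  intros. apply pow_lt, sqrt_lt_R0, Rdiv_lt_0_compat; auto.
  now apply Rmult_lt_0_compat.
Qed.

Lemma energy_const_pos k rho c alpha :
  0 < k -> 0 < rho -> 0 < c -> 0 <= alpha -> 0 < energy_const k rho c alpha.
Proof.
  intros hk hr hc ha. pose proof (diffusion_sq_pos k rho c hk hr hc).
  apply Rdiv_lt_0_compat; lra.
Qed.

(** Condition (iv) at all times fixes the shape of [s]; after that, (i) and the face condition are
    needed only at [t = 1], where the powers of [t] equal 1 and [s 1 = sg]. *)
Lemma stefan_problem_self_similar k rho c gamma theta alpha e face T s :
  0 < k -> 0 < rho -> 0 < c -> 0 < gamma -> 0 < theta -> 0 <= alpha -> 0 <= e ->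
  robin_face theta alpha e face ->
  stefan_problem k rho c gamma theta alpha face T s ->
  0 < s 1 /\
  front_fun (energy_const k rho c alpha) (growth_const k gamma theta) alpha e (s 1) = 0 /\
  self_similar alpha theta (lin_coef (growth_const k gamma theta) alpha (s 1))
    (quad_coef (energy_const k rho c alpha) (growth_const k gamma theta) alpha (s 1))
    (s 1) T s.
Proof.
  intros hk hrho hc hg hth ha he hface [[hcont [_ [hs [A [B hT]]]]] [hP hs0]].
  assert (hiv : forall t, 0 < t ->
    gamma * (Rpower (s t) alpha * Derive s t)
    = k * (Rpower t (alpha / 2) * theta * A / s t)).
  { intros t ht. destruct (hs t ht) as [hst _].
    destruct (hP t ht) as [Tx0 [Txs [_ [hTs [_ [_ [_ hlast]]]]]]].
    rewrite (is_left_derive_unique _ _ _ _ hTs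
      (profile_left_derive _ _ _ A B hst (fun x hx => hT x t ht hx))) in hlast.
    lra. }
  destruct (front_ode_self_similar alpha (k * theta * A / gamma) s) as [h2K hsim]; auto.
  { intros t ht. split; apply (hs t ht). }
  { intros t ht. destruct (hs t ht) as [hst _].
    rewrite Rpower_succ by auto.
    replace (Rpower (s t) alpha * s t * Derive s t)
      with (s t / gamma * (gamma * (Rpower (s t) alpha * Derive s t))) by (field; lra).
    rewrite hiv by auto. field; lra. }
  destruct (hs 1 Rlt_0_1) as [hs1 _].
  set (sg := s 1) in *.
  assert (hA : A = lin_coef (growth_const k gamma theta) alpha sg).
  { rewrite lin_coef_eq, <- h2K by auto. unfold growth_const. field; lra. }
  assert (hsol : self_similar alpha theta A B sg T s) by (split; auto).
  assert (hsys : energy_const k rho c alpha * sg ^ 2 * (A / 2 + B / 3) = B /\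
                 e * (A + 2 * B) + sg * (A + B - 1) = 0).
  { destruct (hP 1 Rlt_0_1) as [Tx0 [Txs [hTx0 [_ [hen [hf _]]]]]].
    pose proof (profile_right_derive _ _ _ A B hs1 (fun x hx => hT x 1 Rlt_0_1 hx)) as hr.
    rewrite (is_right_derive_unique _ _ _ _ hTx0 hr) in hf, hen. clear hr hTx0.
    fold sg in hf, hen. split.
    - apply is_derive_unique in hen.
      rewrite (is_derive_unique _ _ _
        (self_similar_derive_energy _ _ _ _ _ _ _ 1 hs1 hsol Rlt_0_1)) in hen.
      (* By (iv) the front term in (i) equals [theta A / sg], which cancels the [A] in the flux at
         [x = 0]; the right side becomes [2 a^2 theta B / sg]. *)
      replace (gamma / k * Rpower sg alpha * Derive s 1)
        with (/ k * (gamma * (Rpower sg alpha * Derive s 1))) in hen by (field; lra).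
      pose proof (hiv 1 Rlt_0_1) as hiv1. fold sg in hiv1. rewrite hiv1 in hen.
      rewrite sqrt_1 in hen. unfold Rpower in hen.
      rewrite ln_1, Rmult_0_r, exp_0 in hen.
      pose proof (diffusion_sq_pos k rho c hk hrho hc).
      unfold energy_const. set (a2 := diffusion_a k rho c ^ 2) in *.
      apply (Rmult_eq_reg_l (2 * a2 * theta / sg)).
      2:{ apply Rgt_not_eq, Rdiv_lt_0_compat; auto. nra. }
      transitivity (theta * sg * (A / 2 + B / 3) * ((alpha + 1) / 2) * 1 / 1);
        [field; lra|].
      rewrite hen. field; lra.
    - apply (hface A B sg 1); auto; try lra.
      rewrite (hT 0 1) in hf by (fold sg; lra).
      replace (A * (1 - 0 / s 1) + B * (1 - 0 / s 1) ^ 2) with (A + B) in hf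
        by (fold sg; field; lra).
      rewrite sqrt_1, Rmult_1_r. exact hf. }
  apply (coef_system _ (growth_const k gamma theta) alpha) in hsys; auto.
  - destruct hsys as [hB hF]. rewrite <- hA, <- hB. auto.
  - now apply energy_const_pos.
  - now apply growth_const_pos.
Qed.

(** Both sides of each condition scale with the same power of [t], so a root of the algebraic
    equation gives a pair satisfying them at every time. *)
Lemma self_similar_stefan_problem k rho c gamma theta alpha e face sg :
  0 < k -> 0 < rho -> 0 < c -> 0 < gamma -> 0 < theta -> 0 <= alpha -> 0 <= e ->
  robin_face theta alpha e face ->
  0 < sg ->
  front_fun (energy_const k rho c alpha) (growth_const k gamma theta) alpha e sg = 0 ->
  exists T s, stefan_problem k rho c gamma theta alpha face T s.
Proof.
  intros hk hrho hc hg hth ha he hface hsg hF.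
  set (A := lin_coef (growth_const k gamma theta) alpha sg).
  set (B := quad_coef (energy_const k rho c alpha) (growth_const k gamma theta) alpha sg).
  set (s := fun t => sg * sqrt t).
  set (T := fun x t => Rpower t (alpha / 2) * theta *
            (A * (1 - x / s t) + B * (1 - x / s t) ^ 2)).
  destruct (proj2 (coef_system (energy_const k rho c alpha) (growth_const k gamma theta)
    alpha e sg A B (energy_const_pos k rho c alpha hk hrho hc ha)
    (growth_const_pos k gamma theta hk hg hth) he hsg eq_refl) (conj eq_refl hF))
    as [h1 h2].
  assert (hsim : self_similar alpha theta A B sg T s) by (split; auto).
  assert (hpos : forall t, 0 < t -> 0 < s t).
  { intros t ht. apply Rmult_lt_0_compat; auto. now apply sqrt_lt_R0. }
  assert (hA : gamma * (Rpower sg alpha * sg * sg) = 2 * k * theta * A).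
  { unfold A, lin_coef, growth_const. rewrite Rpower_succ by auto. field; lra. }
  exists T, s. split; [split; [|split; [|split]]|split].
  - intros t _. apply continuous_within; auto.
    apply (continuous_scal_r sg sqrt).
    apply continuous_sqrt.
  - intros t ht. apply Rmult_le_pos; [lra|apply sqrt_pos].
  - intros t ht. split; [|split]; auto.
    + eexists. now apply is_derive_front.
    + apply (continuous_ext_loc _ (fun u => sg / (2 * sqrt u))).
      * generalize (locally_pos t ht). apply filter_imp. intros u hu.
        symmetry. now apply is_derive_unique, is_derive_front.
      * apply (ex_derive_continuous (V := R_NormedModule)).
        pose proof (sqrt_lt_R0 t ht). auto_derive. split; lra.
  - exists A, B. auto.
  - intros t ht. pose proof (hpos t ht) as hst. pose proof (sqrt_lt_R0 t ht) as hr.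
    assert (hiv : gamma * (Rpower (s t) alpha * Derive s t)
                  = k * (Rpower t (alpha / 2) * theta * A / s t)).
    { rewrite (is_derive_unique s _ _ (is_derive_front sg t ht)). unfold s.
      rewrite <- Rpower_mult_distr, Rpower_sqrt_base by auto.
      transitivity (gamma * (Rpower sg alpha * sg * sg)
        * Rpower t (alpha / 2) / (2 * sg * sqrt t)); [field; lra|].
      rewrite hA. field; lra. }
    exists (- (Rpower t (alpha / 2) * theta * (A + 2 * B) / s t)),
      (- (Rpower t (alpha / 2) * theta * A / s t)).
    split; [|split; [|split; [|split; [|split]]]].
    + now apply profile_right_derive.
    + now apply profile_left_derive with B.
    + match goal with |- is_derive _ _ ?l => replace l with
        (theta * sg * (A / 2 + B / 3) * ((alpha + 1) / 2)
         * Rpower t (alpha / 2) / sqrt t) end.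
      { now apply self_similar_derive_energy. }
      replace (gamma / k * Rpower (s t) alpha * Derive s t)
        with (/ k * (gamma * (Rpower (s t) alpha * Derive s t))) by (field; lra).
      rewrite hiv. unfold s.
      pose proof (diffusion_sq_pos k rho c hk hrho hc).
      unfold energy_const in h1. set (a2 := diffusion_a k rho c ^ 2) in *.
      set (q := Rpower t _).
      (* The factor in the second line is the left side of the energy balance [h1], so it can be
         replaced by [B]. *)
      transitivity (2 * a2 * q * theta / (sg * sqrt t) *
        ((alpha + 1) / (4 * a2) * sg ^ 2 * (A / 2 + B / 3))); [field; lra|].
      rewrite h1. field; lra.
    + replace (T 0 t) with (Rpower t (alpha / 2) * theta * (A + B))
        by (unfold T; field; lra).
      apply hface; auto.
    + unfold T. field; lra.
    + lra.
  - unfold s. rewrite sqrt_0. ring.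
Qed.

(** * Unique solvability and the limit of large [h] *)

Lemma stefan_problem_unique_solution k rho c gamma theta alpha e face :
  0 < k -> 0 < rho -> 0 < c -> 0 < gamma -> 0 < theta -> 0 <= alpha -> 0 <= e ->
  robin_face theta alpha e face ->
  has_unique_solution (stefan_problem k rho c gamma theta alpha face).
Proof.
  intros hk hrho hc hg hth ha he hface.
  pose proof (energy_const_pos k rho c alpha hk hrho hc ha) as hm.
  pose proof (growth_const_pos k gamma theta hk hg hth) as hkap.
  destruct (front_root_exists _ _ alpha e hm hkap ha he) as [sg [hsg hF]].
  destruct (self_similar_stefan_problem k rho c gamma theta alpha e face sg)
    as [T [s h]]; auto.
  exists T, s. split; auto. intros T' s' h'.
  destruct (stefan_problem_self_similar _ _ _ _ _ _ e _ _ _ hk hrho hc hg hth ha he hface h)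
    as [p1 [f1 [e1 t1]]].
  destruct (stefan_problem_self_similar _ _ _ _ _ _ e _ _ _ hk hrho hc hg hth ha he hface h')
    as [p2 [f2 [e2 t2]]].
  (* The front at time 1 is the unique root, and it determines the front, both coefficients and
     hence the temperature. *)
  assert (heq : s 1 = s' 1) by 
    (apply (front_root_unique _ _ alpha e _ _ hm hkap ha he p1 p2 f1 f2)).
  rewrite <- heq in e2, t2.
  assert (hss : forall t, 0 <= t -> s t = s' t)
    by (intros t ht; rewrite e1, e2; auto).
  split; auto. intros x t ht hx.
  assert (hst : s t = s' t) by (apply hss; lra).
  rewrite t1, t2; auto; rewrite <- hst; auto.
Qed.

Theorem theorem4p3 (k rho c gamma theta alpha : R)
  (hk : 0 < k) (hrho : 0 < rho) (hc : 0 < c) (hgamma : 0 < gamma)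
  (htheta : 0 < theta) (halpha : 0 <= alpha) :
  (forall h : R, 0 < h ->
     has_unique_solution (P2h k rho c gamma theta alpha h)) /\
  has_unique_solution (P2 k rho c gamma theta alpha) /\
  (forall (T2h : R -> R -> R -> R) (s2h : R -> R -> R)
          (T2 : R -> R -> R) (s2 : R -> R),
     (forall h : R, 0 < h ->
        P2h k rho c gamma theta alpha h (T2h h) (s2h h)) ->
     P2 k rho c gamma theta alpha T2 s2 ->
     (forall t : R, 0 < t ->
        is_lim (fun h => s2h h t) p_infty (s2 t)) /\
     (forall x t : R, 0 < t -> 0 < x < s2 t ->
        is_lim (fun h => T2h h x t) p_infty (T2 x t))).
Proof.
  assert (hpos : forall h, 0 < h -> 0 <= k / h)
    by (intros h hh; apply Rlt_le, Rdiv_lt_0_compat; auto).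
  split; [|split].
  - intros h hh. apply stefan_problem_unique_solution with (k / h); auto.
    now apply robin_face_convective.
  - apply stefan_problem_unique_solution with 0; auto; try lra.
    now apply robin_face_dirichlet.
  - intros Th sh T0 s0 hh h0.
    pose proof (energy_const_pos k rho c alpha hk hrho hc halpha) as hm.
    pose proof (growth_const_pos k gamma theta hk hgamma htheta) as hkap.
    destruct (stefan_problem_self_similar _ _ _ _ _ _ 0 _ _ _ hk hrho hc hgamma htheta
      halpha (Rle_refl 0) (robin_face_dirichlet theta alpha htheta) h0)
      as [p0 [f0 [e0 t0]]].
    assert (hsim := fun h hp => stefan_problem_self_similar _ _ _ _ _ _ (k / h) _ _ _
      hk hrho hc hgamma htheta halpha (hpos h hp)
      (robin_face_convective k theta alpha h hk htheta hp) (hh h hp)).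
    set (m := energy_const k rho c alpha) in *.
    set (kap := growth_const k gamma theta) in *.
    assert (hlim : is_lim (fun h => sh h 1) p_infty (s0 1)).
    { apply (front_root_lim m kap alpha k); auto.
      intros h hp. destruct (hsim h hp) as [q1 [q2 _]]. auto. }
    assert (hlims : forall t, 0 < t -> is_lim (fun h => sh h t) p_infty (s0 t)).
    { intros t ht. rewrite e0 by lra.
      apply (is_lim_ext_loc (fun h => sh h 1 * sqrt t)).
      - exists 0. intros h hp. destruct (hsim h hp) as [_ [_ [hs _]]].
        symmetry. apply hs. lra.
      - apply (is_lim_scal_r _ (sqrt t) p_infty (s0 1) hlim). }
    split; auto. intros x t ht hx.
    pose proof (sqrt_lt_R0 t ht) as hr.
    (* The temperature at the fixed point [(x, t)] as a function of the front coefficient alone; [h]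
       enters only through [sh h 1]. *)
    set (Phi := fun sg => Rpower t (alpha / 2) * theta *
      (lin_coef kap alpha sg * (1 - x / (sg * sqrt t))
       + quad_coef m kap alpha sg * (1 - x / (sg * sqrt t)) ^ 2)).
    rewrite t0 by lra. rewrite (e0 t) by lra. fold (Phi (s0 1)).
    apply (is_lim_ext_loc (fun h => Phi (sh h 1))).
    (* Since the fronts converge, [x < sh h t] for large [h], and there the profile formula applies.
       The gap [s0 t - x] serves as the tolerance. *)
    + assert (hx' := proj2 (is_lim_spec _ _ _) (hlims t ht)). simpl in hx'.
      assert (hgap : 0 < s0 t - x) by lra.
      destruct (hx' (mkposreal _ hgap)) as [M hM]. simpl in hM.
      exists (Rmax 0 M). intros h hM'.
      assert (hp : 0 < h) by (eapply Rle_lt_trans; [apply Rmax_l|apply hM']).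
      assert (hlt := hM h (Rle_lt_trans _ _ _ (Rmax_r 0 M) hM')).
      apply Rabs_lt_between in hlt.
      destruct (hsim h hp) as [_ [_ [hs hT]]].
      rewrite hT by lra. rewrite (hs t) by lra. reflexivity.
    + apply (filterlim_comp _ _ _ (fun h => sh h 1) Phi _ (locally (s0 1))); [exact hlim|].
      (* The limit coefficient lies strictly below the pole of [quad_coef], so [Phi] is continuous
         there. *)
      assert (h3 := front_root_lt m kap alpha 0 _ hm hkap (Rle_refl 0) p0 f0).
      assert (hu : continuous (fun sg => 1 - x / (sg * sqrt t)) (s0 1)).
      { apply (ex_derive_continuous (V := R_NormedModule)).
        auto_derive. nra. }
      assert (hu2 : continuous (fun sg => (1 - x / (sg * sqrt t)) ^ 2) (s0 1)).
      { apply (ex_derive_continuous (V := R_NormedModule)).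
        auto_derive. nra. }
      apply (continuous_scal_r (Rpower t (alpha / 2) * theta)
        (fun sg => lin_coef kap alpha sg * (1 - x / (sg * sqrt t))
          + quad_coef m kap alpha sg * (1 - x / (sg * sqrt t)) ^ 2)).
      apply (continuous_plus (V := R_NormedModule)).
      * apply (continuous_mult (K := R_AbsRing)); auto.
        now apply continuous_lin_coef.
      * apply (continuous_mult (K := R_AbsRing)); auto.
        now apply continuous_quad_coef.
Qed.
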